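(* Let $\Omega$ be a subset of a reflexive Banach space $X$, let $\bar x\in\Omega$, and let $\Lambda_w:=T_w(\bar x;\Omega)$. Then, given any $d\in\Lambda_w$ and $x^*\in\widehat N(d;\Lambda_w)$, and given any sequences $\{x_k\}\subset\Omega$ and $t_k\downarrow 0$ with $(x_k-\bar x)/t_k\to d$ weakly in $X$, the following holds: for any $\varepsilon>0$ there exists $\delta\in(0,\varepsilon)$ such that $$\limsup_{k\to\infty}\Big[\sup\Big\{\frac{\langle x^*,z-x_k\rangle}{t_k}\ \Big|\ z\in\Omega\cap(x_k+t_k\delta\mathbb{B})\Big\}\Big]\le 2\varepsilon\delta.$$ In particular, the set $\Omega$ has the tangential approximate normality (TAN) property at $\bar x$.
   Context: $X$ is a Banach space with dual $X^*$, pairing $\langle\cdot,\cdot\rangle$, and closed unit ball $\mathbb{B}\subset X$. $t_k\downarrow 0$ means $t_k>0$ and $t_k\to 0$. Weak contingent cone: $T_w(\bar x;\Omega)=\{v\in X\mid \exists\, t_k\downarrow 0,\ v_k\to v \text{ weakly, with } \bar x+t_kv_k\in\Omega\ \forall k\in\mathbb{N}\}$. Fréchet normal cone to a set $\Lambda$ at $d\in\Lambda$: $$\widehat N(d;\Lambda)=\Big\{x^*\in X^*\Big|\ \limsup_{v\to d,\,v\in\Lambda,\,v\ne d}\frac{\langle x^*,v-d\rangle}{\|v-d\|}\le 0\Big\}.$$ TAN property: for $d\in\Lambda_w=T_w(\bar x;\Omega)$ let $\mathcal{T}_d^w$ be the collection of all sequences $\{x_k\}\subset\Omega$ such that $(x_k-\bar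 x)/t_k\to d$ weakly for some $t_k\downarrow 0$. The set $\Omega$ has the tangential approximate normality (TAN) property at $\bar x\in\Omega$ if, whenever $d\in\Lambda_w$ and $x^*\in\widehat N(d;\Lambda_w)$, there is a sequence $\{x_k\}\in\mathcal{T}_d^w$ (with corresponding $t_k\downarrow 0$) such that for any $\varepsilon>0$ there exists $\delta\in(0,\varepsilon)$ for which the displayed $\limsup$ inequality of the claim holds. *)

(* Defs.v *)
From HB Require Import structures.
From mathcomp Require Import all_boot all_order all_algebra.
From mathcomp Require Import all_classical all_reals all_analysis.

Set Implicit Arguments.
Unset Strict Implicit.
Unset Printing Implicit Defensive.

Import Order.TTheory GRing.Theory Num.Theory.
Import numFieldNormedType.Exports.

Local Open Scope classical_set_scope.
Local Open Scope ring_scope.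

(* The library has no topological dual: it is built here as the subtype of the
   functions that are linear and continuous, with the operator norm. *)
Section Dual.
Context {R : realType} (X : normedModType R).

Definition continuous_scalar : {pred X -> R^o} :=
  [pred f : X -> R^o | `[< linear f /\ continuous f >]].

Lemma continuous_scalarP (f : X -> R^o) :
  reflect (linear f /\ continuous f) (f \in continuous_scalar).
Proof. exact: asboolP. Qed.

Lemma continuous_scalar_submod : submod_closed continuous_scalar.
Proof.
split.
  apply/continuous_scalarP; split; last by move=> x; exact: cvg_cst.
  by move=> a x y; rewrite /GRing.zero/= scaler0 addr0.
move=> a f g /continuous_scalarP[lf cf] /continuous_scalarP[lg cg].
apply/continuous_scalarP; split.
  move=> b x y; rewrite !fctE lf lg !scalerDr !scalerA [a * b]mulrC.
  by rewrite addrACA.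
move=> x; rewrite fctE.
by apply: cvgD; [apply: cvgZl_tmp; exact: cf | exact: cg].
Qed.

HB.instance Definition _ := GRing.isSubmodClosed.Build R (X -> R^o)
  continuous_scalar continuous_scalar_submod.

Record dual := Dual {
  dual_fun :> X -> R^o ;
  _ : dual_fun \in continuous_scalar }.

HB.instance Definition _ := [isSub for dual_fun].
HB.instance Definition _ := [Choice of dual by <:].
HB.instance Definition _ := [SubChoice_isSubLmodule of dual by <:].
End Dual.

Arguments continuous_scalar {R} X.

Section DualNorm.
Context {R : realType} {X : normedModType R}.
Implicit Types (f g : dual X) (x : X).

Lemma dual_is_linear f : linear (f : X -> R^o).
Proof. by case: f => f /= /continuous_scalarP[]. Qed.

HB.instance Definition _ f :=
  GRing.isLinear.Build R X R^o *:%R (dual_fun f) (dual_is_linear f).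

Lemma dual_continuous f : continuous (f : X -> R^o).
Proof. by case: f => f /= /continuous_scalarP[]. Qed.

Definition unit_ball : set X := [set b | `|b| <= 1].

Definition dual_norm f : R := sup [set `|f b| | b in unit_ball].

Lemma dual_norm_has_sup f : has_sup [set `|f b| | b in unit_ball].
Proof.
split; first by exists `|f 0|, 0 => //; rewrite /unit_ball/= normr0.
have /linear_bounded_continuous/bounded_funP/(_ 1)[M fM] :=
  @dual_continuous f.
by exists M => _ [b b1 <-]; exact: fM.
Qed.

Lemma dual_norm_ub f b : `|b| <= 1 -> `|f b| <= dual_norm f.
Proof.
by move=> b1; apply: ub_le_sup; [case: (dual_norm_has_sup f) | exists b].
Qed.

Lemma dual_norm_le f c :
  (forall b, `|b| <= 1 -> `|f b| <= c) -> dual_norm f <= c.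
Proof.
move=> fc; apply: ge_sup; first by case: (dual_norm_has_sup f).
by move=> _ [b b1 <-]; exact: fc.
Qed.

Lemma dual_norm_ge f x : `|f x| <= dual_norm f * `|x|.
Proof.
have [->|x0] := eqVneq x 0; first by rewrite raddf0 !normr0 mulr0.
have nx : 0 < `|x| by rewrite normr_gt0.
rewrite -ler_pdivrMr//.
have -> : `|f x| / `|x| = `|f (`|x|^-1 *: x)|.
  by rewrite linearZ/= normrZ normfV normr_id mulrC.
by apply: dual_norm_ub; rewrite normrZ normfV normr_id mulVf// gt_eqF.
Qed.

Lemma ler_dual_normD f g : dual_norm (f + g) <= dual_norm f + dual_norm g.
Proof.
apply: dual_norm_le => b b1; rewrite (le_trans (ler_normD _ _))//.
by apply: lerD; exact: dual_norm_ub.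
Qed.

Lemma dual_normZ (a : R) f : dual_norm (a *: f) = `|a| * dual_norm f.
Proof.
have le a' f' : dual_norm (a' *: f') <= `|a'| * dual_norm f'.
  apply: dual_norm_le => b b1; rewrite normrZ.
  by rewrite ler_wpM2l// dual_norm_ub.
apply/eqP; rewrite eq_le le/=.
have [->|a0] := eqVneq a 0.
  rewrite normr0 mul0r; apply: le_trans (normr_ge0 ((0 *: f) 0)) _.
  by apply: dual_norm_ub; rewrite normr0.
rewrite -ler_pdivlMl ?normr_gt0// -normfV.
by rewrite -[in leLHS](scale1r f) -(mulVf a0) -scalerA.
Qed.

Lemma dual_norm_eq0 f : dual_norm f = 0 -> f = 0.
Proof.
move=> f0; apply/val_inj/funext => x /=.
by apply/eqP; rewrite -normr_le0 (le_trans (dual_norm_ge f x))// f0 mul0r.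
Qed.

HB.instance Definition _ := Lmodule_isNormed.Build R (dual X)
  ler_dual_normD dual_normZ dual_norm_eq0.

Lemma dual_normE f : `|f| = dual_norm f.
Proof. by []. Qed.

End DualNorm.

Section Reflexivity.
Context {R : realType} (X : normedModType R).

Lemma dual_eval_continuous_scalar (x : X) :
  (fun f : dual X => f x : R^o) \in continuous_scalar (dual X).
Proof.
have lin : linear (fun f : dual X => f x : R^o) by [].
apply/continuous_scalarP; split=> //.
pose E : {linear dual X -> R^o} :=
  HB.pack (fun f : dual X => f x : R^o) (GRing.isLinear.Build _ _ _ _ _ lin).
apply: (@bounded_linear_continuous _ _ _ E).
apply/bounded_funP => r; exists (r * `|x|) => f fr /=.
by rewrite (le_trans (dual_norm_ge f x))// ler_wpM2r.
Qed.

Definition bidual_embedding (x : X) : dual (dual X) :=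
  Dual (dual_eval_continuous_scalar x).

Definition reflexive_space : Prop := range bidual_embedding = setT.

End Reflexivity.

Section Tangential.
Context {R : realType} {X : normedModType R}.
Implicit Types (Omega Lambda : set X) (x v : nat -> X) (t : nat -> R).

Definition weakly_cvg v (l : X) : Prop :=
  forall f : dual X, f (v k) @[k --> \oo] --> f l.

Definition decreases_to0 t : Prop :=
  (forall k, 0 < t k) /\ t k @[k --> \oo] --> 0.

Definition weak_contingent_cone (xbar : X) Omega : set X :=
  [set w | exists t v, [/\ decreases_to0 t, weakly_cvg v w &
    forall k, Omega (xbar + t k *: v k)]].

(* When d is an isolated point of Lambda the limsup is -oo, so that every
   functional is a normal. *)
Definition frechet_normal_cone (d : X) Lambda : set (dual X) :=
  [set xs : dual X |
    (limf_esup (fun v : X => (xs (v - d) / `|v - d|)%:E)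
       (within Lambda d^') <= 0)%E].

Definition weak_tangent_seq Omega (xbar d : X) x t : Prop :=
  [/\ forall k, Omega (x k), decreases_to0 t &
    weakly_cvg (fun k => (t k)^-1 *: (x k - xbar)) d].

Definition closed_ball_at (c : X) (r : R) : set X :=
  [set c + r *: b | b in unit_ball].

Definition approx_normal_ineq Omega (xs : dual X) x t (eps delta : R) : Prop :=
  (limn_esup (fun k => ereal_sup
     [set (xs (z - x k) / t k)%:E | z in
        Omega `&` closed_ball_at (x k) (t k * delta)])
   <= (2 * eps * delta)%:E)%E.

Definition TAN Omega (xbar : X) : Prop :=
  forall d xs,
    weak_contingent_cone xbar Omega d ->
    frechet_normal_cone d (weak_contingent_cone xbar Omega) xs ->
    exists x t, weak_tangent_seq Omega xbar d x t /\
      forall eps, 0 < eps -> exists delta,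
        [/\ 0 < delta, delta < eps & approx_normal_ineq Omega xs x t eps delta].

End Tangential.

(* Main.v *)
Require Import Defs.
From HB Require Import structures.
From mathcomp Require Import all_boot all_order all_algebra.
From mathcomp Require Import all_classical all_reals all_analysis.
From mathcomp Require Import lra.

Set Implicit Arguments.
Unset Strict Implicit.
Unset Printing Implicit Defensive.

Import Order.TTheory GRing.Theory Num.Theory.
Import numFieldNormedType.Exports.

Local Open Scope classical_set_scope.
Local Open Scope ring_scope.

(* Suppose the inequality fails for a delta below eps and below the radius on
   which <xs, v - d> <= eps |v - d| holds for v in the cone. Then there are
   indices k_n >= n and vectors b_n in the unit ball with
   x_(k_n) + t_(k_n) delta b_n in Omega and <xs, b_n> >= 2 eps. By reflexivity a
   subsequence of b_n converges weakly to some w with |w| <= 1 and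
   <xs, w> >= 2 eps. As d + delta w lies in the weak contingent cone,
   <xs, w> <= eps |w| <= eps, a contradiction.

   Weak sequential compactness is obtained without separability of the dual.
   Reflexivity gives every bounded sequence v a weak limit x along an
   ultrafilter. Choose k_n >= n so that v_(k_n) approaches x on countably many
   functionals that norm the rational combinations of v. All weak limits of
   v \o k along ultrafilters lie in the closed span of v and agree with x on
   these functionals, hence equal x. *)

(** * Sublinear functionals and the Hahn-Banach theorem *)

Definition sublinear (R : realType) (V : lmodType R) (p : V -> R) : Prop :=
  (forall x y, p (x + y) <= p x + p y) /\
  (forall a x, 0 < a -> p (a *: x) <= a * p x).

Section SublinearTheory.
Context {R : realType} {V : lmodType R}.
Implicit Types (p q : V -> R) (x y w : V) (A : set (V -> R)).

Lemma sublinear0 p : sublinear p -> p 0 = 0.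
Proof.
move=> [_ pZ].
have := pZ 2 0 (ltr0Sn _ _); have := pZ 2^-1 0.
rewrite !scaler0 invr_gt0 ltr0Sn.
by move=> /(_ isT) h1 h2; lra.
Qed.

Lemma sublinearZ p a x : sublinear p -> 0 <= a -> p (a *: x) = a * p x.
Proof.
move=> sp; rewrite le_eqVlt => /orP[/eqP<-|a0].
  by rewrite scale0r mul0r sublinear0.
have [_ pZ] := sp; apply/eqP; rewrite eq_le pZ//=.
have := pZ a^-1 (a *: x); rewrite invr_gt0 => /(_ a0).
by rewrite scalerA mulVf ?gt_eqF// scale1r ler_pdivlMl.
Qed.

Lemma sublinear_geN p x : sublinear p -> - p (- x) <= p x.
Proof.
move=> sp; have [pD _] := sp; have := pD x (- x).
by rewrite subrr sublinear0//; lra.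
Qed.

(* The greatest sublinear q <= p with q (- w) <= - p w. *)
Definition pull p w x : R := inf [set p (x + t *: w) - t * p w | t in >= 0].

Lemma pull_le p w t x : sublinear p -> 0 <= t ->
  pull p w x <= p (x + t *: w) - t * p w.
Proof.
move=> sp t0; apply: ge_inf; last by exists t.
(* A lower bound of the set, since [s * p w = p (s *: w) <= p (x + s *: w) + p (- x)]. *)
exists (- p (- x)) => _ [s s0 <-].
have [pD _] := sp; have := pD (x + s *: w) (- x).
by rewrite addrC addKr sublinearZ//; lra.
Qed.

Lemma le_pull p w x c :
  (forall t, 0 <= t -> c <= p (x + t *: w) - t * p w) -> c <= pull p w x.
Proof.
move=> h; apply: lb_le_inf; first by exists (p (x + 0 *: w) - 0 * p w), 0 => /=.
by move=> _ [t t0 <-]; exact: h.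
Qed.

Lemma pull_le_id p w x : sublinear p -> pull p w x <= p x.
Proof.
move=> sp; have := pull_le w x sp (lexx 0).
by rewrite scale0r mul0r addr0 subr0.
Qed.

Lemma pull_opp p w : sublinear p -> pull p w (- w) <= - p w.
Proof.
move=> sp; have := pull_le w (- w) sp ler01.
by rewrite scale1r mul1r addNr sublinear0// sub0r.
Qed.

Lemma pull_sublinear p w : sublinear p -> sublinear (pull p w).
Proof.
move=> sp; have [pD pZ] := sp; split=> [x y|a x a0].
  rewrite -lerBlDr; apply: le_pull => t t0.
  rewrite lerBlDl -lerBlDr; apply: le_pull => s s0; rewrite lerBlDl.
  apply: le_trans (pull_le w _ sp (addr_ge0 t0 s0)) _.
  rewrite scalerDl addrACA; have := pD (x + t *: w) (y + s *: w); lra.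
rewrite -ler_pdivrMl//; apply: le_pull => t t0; rewrite ler_pdivrMl//.
apply: le_trans (pull_le w _ sp (mulr_ge0 (ltW a0) t0)) _.
rewrite -scalerA -scalerDr mulrBr mulrA lerD2r; exact: pZ.
Qed.

(** Subadditivity passes to the infimum because of two members of a chain the smaller one can be
    used at both [x] and [y]. The bound [- p (- x)] keeps the infimum finite. *)
Lemma chain_inf_sublinear p A : A !=set0 ->
  (forall q, A q -> sublinear q /\ forall x, q x <= p x) ->
  (forall q1 q2, A q1 -> A q2 ->
     (forall x, q1 x <= q2 x) \/ (forall x, q2 x <= q1 x)) ->
  let m x := inf [set q x | q in A] in
  sublinear m /\ forall q x, A q -> m x <= q x.
Proof.
move=> [q0 Aq0] Ap Atot m.
have mle q x : A q -> m x <= q x.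
  move=> Aq; apply: ge_inf; last by exists q.
  exists (- p (- x)) => _ [r Ar <-]; have [sr rp] := Ap _ Ar.
  by have := sublinear_geN x sr; have := rp (- x); lra.
have le_m x c : (forall q, A q -> c <= q x) -> c <= m x.
  move=> h; apply: lb_le_inf; first by exists (q0 x), q0.
  by move=> _ [q Aq <-]; exact: h.
split=> //; split=> [x y|a x a0].
  rewrite -lerBlDr; apply: (le_m _ _) => q1 Aq1.
  rewrite lerBlDl -lerBlDr; apply: (le_m _ _) => q2 Aq2; rewrite lerBlDl.
  have [[q1D _] _] := Ap _ Aq1; have [[q2D _] _] := Ap _ Aq2.
  case: (Atot _ _ Aq1 Aq2) => h.
    by have := mle _ (x + y) Aq1; have := q1D x y; have := h y; lra.
  by have := mle _ (x + y) Aq2; have := q2D x y; have := h x; lra.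
rewrite -ler_pdivrMl//; apply: (le_m _ _) => q Aq; rewrite ler_pdivrMl//.
by apply: le_trans (mle _ _ Aq) _; have [[_ ->]] := Ap _ Aq.
Qed.

Lemma minimal_sublinear p : sublinear p -> exists q,
  [/\ sublinear q, forall x, q x <= p x &
    forall r, sublinear r -> (forall x, r x <= q x) -> r = q].
Proof.
move=> sp; pose T := {q : V -> R | sublinear q /\ forall x, q x <= p x}.
pose below (q r : T) := `[< forall x, sval r x <= sval q x >].
have [| | | |q qmin] := @Zorn T below.
- by move=> q; apply/asboolP.
- move=> q r s /asboolP qr /asboolP rs; apply/asboolP => x.
  exact: le_trans (rs x) (qr x).
- move=> [q Pq] [r Pr] /asboolP/= qr /asboolP/= rq; apply: eq_exist.
  by apply/funext => x; apply/eqP; rewrite eq_le qr rq.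
(* The empty chain is bounded by [p] itself; [inf] would give the default value 0 there. *)
- move=> A Atot; have [->|/set0P[q0 Aq0]] := eqVneq A set0.
    by exists (exist _ p (conj sp (fun=> lexx _))).
  pose B := [set sval q | q in A].
  have [] := @chain_inf_sublinear p B.
  + by exists (sval q0), q0.
  + by move=> _ [q _ <-]; exact: svalP q.
  + move=> _ _ [q Aq <-] [r Ar <-].
    by case: (Atot _ _ Aq Ar) => /asboolP h; [right|left].
  set m := fun x => _; move=> sm mB.
  have mp x : m x <= p x.
    apply: le_trans (mB (sval q0) x _) _; first by exists q0.
    by case: (svalP q0).
  exists (exist _ m (conj sm mp)) => q Aq; apply/asboolP => x /=.
  by apply: mB; exists q.
case: q qmin => q [sq qp] qmin; exists q; split=> // r sr rq.
have rp x : r x <= p x by exact: le_trans (rq x) (qp x).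
by apply: congr1 sval _ _ (qmin (exist _ r (conj sr rp)) _); exact/asboolP.
Qed.

(* By minimality pull q y = q, which makes q superadditive. *)
Lemma minimal_sublinear_linear q : sublinear q ->
  (forall r, sublinear r -> (forall x, r x <= q x) -> r = q) ->
  linear (q : V -> R^o).
Proof.
move=> sq qmin; have [qD _] := sq.
have D x y : q (x + y) = q x + q y.
  apply/eqP; rewrite eq_le qD/= -lerBrDr.
  rewrite -[leLHS](congr1 (@^~ x) (qmin _ (pull_sublinear y sq) _)).
    by have := pull_le y x sq ler01; rewrite scale1r mul1r.
  by move=> z; exact: pull_le_id.
have N x : q (- x) = - q x.
  by have := D x (- x); rewrite subrr sublinear0//; lra.
have Z a x : q (a *: x) = a * q x.
  have [a0|a0] := leP 0 a; first exact: sublinearZ.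
  by rewrite -[a]opprK scaleNr N sublinearZ ?mulNr// oppr_ge0 ltW.
by move=> a x y; rewrite D Z.
Qed.

(* Minimality only yields some linear f <= p; pulling p down at - w beforehand
   forces f w = p w. *)
Lemma hahn_banach_sublinear p w : sublinear p -> exists f : V -> R,
  [/\ linear (f : V -> R^o), forall x, f x <= p x & f w = p w].
Proof.
move=> sp; have [f [sf fp fmin]] := minimal_sublinear (pull_sublinear w sp).
exists f; split.
- exact: minimal_sublinear_linear.
- by move=> x; apply: le_trans (fp x) _; exact: pull_le_id.
- apply/eqP; rewrite eq_le (le_trans (fp w) (pull_le_id _ _ sp))/=.
  rewrite -lerN2; have := fp (- w); have := pull_opp w sp.
  by have := sublinear_geN (- w) sf; rewrite opprK; lra.
Qed.

End SublinearTheory.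

(** * Norming functionals and approximation by annihilators *)

Section HahnBanachNormed.
Context {R : realType} {X : normedModType R}.
Implicit Types (p : X -> R) (w x y : X) (S : set X) (v : nat -> X).

Lemma hahn_banach_dual p w : sublinear p -> (forall x, p x <= `|x|) ->
  exists f : dual X, (forall x, f x <= p x) /\ f w = p w.
Proof.
move=> sp pn; have [f [lf fp fw]] := hahn_banach_sublinear w sp.
pose F : {linear X -> R^o} :=
  HB.pack (f : X -> R^o) (GRing.isLinear.Build _ _ _ _ _ lf).
have cf : continuous (f : X -> R^o).
  apply: (@bounded_linear_continuous _ _ _ F); apply/bounded_funP => r.
  exists r => x xr; apply: le_trans xr; rewrite ler_norml.
  rewrite (le_trans (fp x) (pn x)) andbT lerNl -(linearN F).
  by rewrite -normrN; exact: le_trans (fp _) (pn _).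
have fd : (f : X -> R^o) \in continuous_scalar X by apply/continuous_scalarP.
by exists (Dual fd).
Qed.

Lemma norming_functional w : exists f : dual X,
  (forall x, `|f x| <= `|x|) /\ f w = `|w|.
Proof.
have [|//|f [fn fw]] := @hahn_banach_dual (fun x => `|x|) w.
  by split=> [x y|a x a0]; [exact: ler_normD | rewrite normrZ gtr0_norm].
exists f; split=> // x; rewrite ler_norml fn andbT lerNl -linearN.
by rewrite -normrN fn.
Qed.

Definition dist_to S x : R := inf [set `|x - y| | y in S].

Lemma dist_to_le S x y : S y -> dist_to S x <= `|x - y|.
Proof. by move=> Sy; apply: ge_inf; [exists 0 => _ [z _ <-] | exists y]. Qed.

Lemma le_dist_to S x c : S !=set0 -> (forall y, S y -> c <= `|x - y|) ->
  c <= dist_to S x.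
Proof.
move=> [z Sz] cS; apply: lb_le_inf; first by exists `|x - z|, z.
by move=> _ [y Sy <-]; exact: cS.
Qed.

(** For a subspace [S], [dist_to S] is the quotient seminorm; it serves as the majorant in
    Hahn-Banach. *)
Lemma dist_to_sublinear S : S 0 ->
  (forall x y, S x -> S y -> S (x + y)) -> (forall a x, S x -> S (a *: x)) ->
  sublinear (dist_to S).
Proof.
move=> S0 SD SZ; have Sn0 : S !=set0 by exists 0.
split=> [x y|a x a0].
  rewrite -lerBlDr; apply: le_dist_to => // x1 Sx1.
  rewrite lerBlDl -lerBlDr; apply: le_dist_to => // y1 Sy1; rewrite lerBlDl.
  apply: le_trans (dist_to_le _ (SD _ _ Sx1 Sy1)) _.
  by rewrite opprD addrACA ler_normD.
rewrite -ler_pdivrMl//; apply: le_dist_to => // y Sy; rewrite ler_pdivrMl//.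
apply: le_trans (dist_to_le _ (SZ a _ Sy)) _.
by rewrite -scalerBr normrZ gtr0_norm.
Qed.

(** Hahn-Banach below [dist_to S] gives [f] with [f w = dist_to S w]. Since [f <= 0] on the subspace
    [S], at [y] and at [- y], [f] vanishes on [S], so [w] is at distance 0. *)
Lemma annihilated_approx S w : S 0 ->
  (forall x y, S x -> S y -> S (x + y)) -> (forall a x, S x -> S (a *: x)) ->
  (forall f : dual X, (forall y, S y -> f y = 0) -> f w = 0) ->
  forall e, 0 < e -> exists2 y, S y & `|w - y| < e.
Proof.
move=> S0 SD SZ fS e e0.
have [|x|f [fd fw]] := @hahn_banach_dual (dist_to S) w.
- exact: dist_to_sublinear.
- by have := dist_to_le x S0; rewrite subr0.
- have fS0 y : S y -> f y <= 0.
    move=> Sy; apply: le_trans (fd y) _; apply: le_trans (dist_to_le y Sy) _.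
    by rewrite subrr normr0.
  have d0 : dist_to S w < e.
    rewrite -fw fS// => y Sy; apply/eqP; rewrite eq_le fS0//=.
    by rewrite -oppr_le0 -linearN fS0// -scaleN1r; exact: SZ.
  have [|_ [y Sy <-] ye] := inf_lt _ d0; first by exists `|w - 0|, 0.
  by exists y.
Qed.

(** The map [phi] lets real and rational coefficients share one definition; the rational
    combinations are indexed by a countable type. *)
Definition lincomb (K : Type) (phi : K -> R) v (s : seq (K * nat)) : X :=
  \sum_(i <- s) phi i.1 *: v i.2.

Lemma lincomb_rat_dense v (s : seq (R * nat)) e : 0 < e ->
  exists q : seq (rat * nat), `|lincomb idfun v s - lincomb ratr v q| < e.
Proof.
rewrite /lincomb; elim: s e => [|[a i] s IH] e e0.
  by exists [::]; rewrite !big_nil subrr normr0.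
have [q qe] := IH _ (divr_gt0 e0 (ltr0Sn R 1)).
(* A coefficient error of at most [c] costs at most [e / 2] in norm; the [+ 1] covers [v i = 0]. *)
pose c := e / 2 / (`|v i| + 1).
have vi0 : 0 < `|v i| + 1 by rewrite ltr_wpDl.
have c0 : 0 < c by rewrite !divr_gt0.
have [|r /[!in_itv]/= /andP[r1 r2]] := @rat_in_itvoo R (a - c) (a + c).
  by rewrite ltrBlDr -addrA ltrDl addr_gt0.
exists ((r, i) :: q); rewrite !big_cons/= opprD addrACA -scalerBl.
apply: le_lt_trans (ler_normD _ _) _; rewrite [e]splitr.
apply: ler_ltD => //; rewrite normrZ.
have : `|a - ratr r| <= c by rewrite ler_norml; apply/andP; split; lra.
move=> /(ler_wpM2r (normr_ge0 (v i)))/le_trans; apply.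
by rewrite /c mulrAC ler_pdivrMr// ler_wpM2l ?lerDl// ltW// divr_gt0.
Qed.

Lemma annihilated_lincomb_approx v w :
  (forall f : dual X, (forall k, f (v k) = 0) -> f w = 0) ->
  forall e, 0 < e ->
    exists q : seq (rat * nat), `|w - lincomb ratr v q| < e.
Proof.
move=> fv e e0; have e20 : 0 < e / 2 by rewrite divr_gt0.
have [|||| _ [s _ <-] se] :=
  @annihilated_approx (range (lincomb idfun v)) w _ _ _ _ _ e20.
- by exists [::]; rewrite // /lincomb big_nil.
- move=> _ _ [s _ <-] [t _ <-]; exists (s ++ t) => //.
  by rewrite /lincomb big_cat.
- move=> a _ [s _ <-]; exists [seq (a * i.1, i.2) | i <- s] => //.
  rewrite /lincomb big_map scaler_sumr; apply: eq_bigr => i _.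
  by rewrite scalerA.
- move=> f f0; apply: fv => k; apply: f0; exists [:: (1, k)] => //.
  by rewrite /lincomb big_seq1 scale1r.
- have [q qs] := lincomb_rat_dense v s e20; exists q.
  by rewrite [e]splitr (le_lt_trans (ler_distD (lincomb idfun v s) _ _))// ltrD.
Qed.

End HahnBanachNormed.

(** * Convergence along ultrafilters *)

Lemma cvgr_unique (R : realType) (T : Type) (F : set_system T)
    {FF : ProperFilter F} (u : T -> R^o) (a b : R^o) :
  u k @[k --> F] --> a -> u k @[k --> F] --> b -> a = b.
Proof. by apply: cvg_unique; exact: norm_hausdorff. Qed.

Lemma ultra_cluster_cvg (S : Type) (T : topologicalType) (U : set_system S)
    (f : S -> T) (l : T) :
  UltraFilter U -> cluster (f @ U) l -> f x @[x --> U] --> l.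
Proof.
move=> UU fl A Al; have [//|UnA] := in_ultra_setVsetC (f @^-1` A) UU.
by have [y []] := fl (~` A) A UnA Al.
Qed.

(** If some neighbourhood [A] of [l] had a preimage outside [F], then [F] restricted to the
    complement of this preimage would be proper. An ultrafilter refining it would contain both the
    preimage and its complement. *)
Lemma cvg_ultra (S : Type) (T : topologicalType) (F : set_system S)
    (f : S -> T) (l : T) : Filter F ->
  (forall U, UltraFilter U -> F `<=` U -> f x @[x --> U] --> l) ->
  f x @[x --> F] --> l.
Proof.
move=> FF h A lA; apply: contrapT => nFA.
have WF : ProperFilter (within (~` (f @^-1` A)) F).
  apply: Build_ProperFilter => WF0; apply: nFA.
  apply: (@filterS _ F _ _ _ _ (WF0 : F (fun x => ~ A (f x) -> False))) => x.
  by move=> /contrapT.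
have [U [UU WU]] := ultraFilterLemma WF.
have UA : U (f @^-1` A).
  by apply: h lA => // B FB; apply: WU; apply: (filterS _ FB).
have UnA : U (~` (f @^-1` A)) by apply: WU; exact: withinT.
by have [x []] := filter_ex (filterI UA UnA).
Qed.

(** * Weak sequential compactness in reflexive spaces *)

Section WeakCompactness.
Context {R : realType} {X : normedModType R}.
Implicit Types (x y : X) (v : nat -> X).

(** By compactness of segments every [f (v k)] has a limit [L f] along [U]. The map [L] is linear
    and bounded on the dual, so reflexivity represents it by a point. *)
Lemma weak_ultralimit T (U : set_system T) (v : T -> X) (M : R) :
  reflexive_space X -> UltraFilter U -> (forall k, `|v k| <= M) ->
  exists x, forall f : dual X, f (v k) @[k --> U] --> f x.
Proof.
move=> hX UU vM.
have fvM (f : dual X) k : `|f (v k) : R| <= dual_norm f * M.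
  apply: le_trans (dual_norm_ge f (v k)) _; apply: ler_wpM2l => //.
  by rewrite -dual_normE.
have /choice[L Llim] (f : dual X) : exists l : R,
    `|l| <= dual_norm f * M /\ (f (v k) : R) @[k --> U] --> l.
  have UM : ((f (v k) : R) @[k --> U])
      `[- (dual_norm f * M), dual_norm f * M]%classic.
    by apply: (@filterE _ U) => k /=; rewrite in_itv/= -ler_norml.
  have [l [/= /[!in_itv]/= lM /ultra_cluster_cvg Ul]] := segment_compact _ UM.
  by exists l; rewrite ler_norml.
have lL : linear (L : dual X -> R^o).
  move=> a f g; apply: (cvgr_unique (Llim (a *: f + g)).2).
  by apply: cvgD; [apply: cvgZl_tmp; exact: (Llim f).2 | exact: (Llim g).2].
pose F : {linear dual X -> R^o} :=
  HB.pack (L : dual X -> R^o) (GRing.isLinear.Build _ _ _ _ _ lL).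
have cL : continuous (L : dual X -> R^o).
  apply: (@bounded_linear_continuous _ _ _ F); apply/bounded_funP => r.
  exists (r * `|M|) => f fr; apply: le_trans (Llim f).1 _.
  apply: le_trans (ler_norm _) _; rewrite normrM ler_wpM2r//.
  by rewrite -[dual_norm f]dual_normE normr_id.
have Ld : (L : dual X -> R^o) \in continuous_scalar (dual X).
  by apply/continuous_scalarP.
have [x _ xL] : range (@bidual_embedding _ X) (Dual Ld) by rewrite hX.
by exists x => f; have := (Llim f).2; rewrite -[L f]/(Dual Ld f) -xL.
Qed.

Lemma weakly_cvg_subseq v (M : R) : reflexive_space X ->
  (forall k, `|v k| <= M) ->
  exists (k : nat -> nat) x, (forall n, (n <= k n)%N) /\ weakly_cvg (v \o k) x.
Proof.
move=> hX vM.
have [U [UU ooU]] := ultraFilterLemma (eventually_filter : ProperFilter \oo).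
have [x Ux] := weak_ultralimit hX UU vM.
have /choice[f fP] (q : seq (rat * nat)) :=
  norming_functional (lincomb ratr v q).
(* Stage [n] only treats the combinations with code at most [n]. These finitely many conditions hold
   together on a member of [U], which meets every tail. *)
have /choice[k kP] (n : nat) : exists m, (n <= m)%N /\
    forall i : 'I_n.+1, if unpickle i is Some q
      then `|f q x - f q (v m)| < n.+1%:R^-1 else true.
  apply: (@filter_ex _ U); apply: filterI.
    by apply: ooU; exists n.
  apply: filter_forall => i; case: unpickle => [q|]; last exact: filterE.
  by have /cvgrPdist_lt := Ux (f q); apply; rewrite invr_gt0.
have fk q : f q (v (k n)) @[n --> \oo] --> f q x.
  apply/cvgrPdist_lt => e e0.
  near=> n.
  have nq : (pickle q < n.+1)%N by rewrite ltnS; near: n; exact: nbhs_infty_ge.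
  have := (kP n).2 (Ordinal nq).
  rewrite (pickleK q : unpickle (Ordinal nq) = Some q) => /lt_trans; apply.
  near: n; exact: (near_infty_natSinv_lt (PosNum e0)).
exists k, x; split=> [n|g]; first exact: (kP n).1.
apply: cvg_ultra => V VV ooV.
have [y Vy] := weak_ultralimit hX VV (fun n => vM (k n)).
suff -> : x = y by exact: Vy.
apply/eqP; rewrite -subr_eq0 -normr_le0.
apply/ler_addgt0Pr => e e0; rewrite add0r.
(* A functional vanishing on all [v k] vanishes at the limits [x] and [y], so [x - y] is within
   [e / 2] of a rational combination. *)
have [h hv|q qe] :=
    @annihilated_lincomb_approx R X v (x - y) _ _ (divr_gt0 e0 (ltr0Sn R 1)).
  have hx : h x = 0.
    apply: cvgr_unique (Ux h) _.
    by under eq_fun do rewrite hv; exact: cvg_cst.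
  have hy : h y = 0.
    apply: cvgr_unique (Vy h) _.
    by under eq_fun do rewrite hv; exact: cvg_cst.
  by rewrite linearB/= hx hy subrr.
have fq0 : f q (x - y) = 0.
  rewrite linearB/=; apply/eqP; rewrite subr_eq0; apply/eqP.
  apply: (cvgr_unique _ (Vy (f q))) => A /fk; exact: ooV.
have [fn fq] := fP q.
(* As [f q] norms the combination and kills [x - y], the norm of the combination is at most its
   distance to [x - y]. *)
have : `|lincomb ratr v q| <= e / 2.
  rewrite -fq -[f q _]subr0 -fq0 -linearB; apply: le_trans (ler_norm _) _.
  by apply: le_trans (fn _) _; rewrite distrC ltW.
have := ler_normD (x - y - lincomb ratr v q) (lincomb ratr v q).
by rewrite subrK; lra.
Unshelve. all: by end_near. Qed.

End WeakCompactness.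

(** * From weak limits to the limsup estimate *)

Lemma weak_limit_norm_le (R : realType) (X : normedModType R) (v : nat -> X)
    (x : X) (M : R) :
  weakly_cvg v x -> (forall k, `|v k| <= M) -> `|x| <= M.
Proof.
move=> vx vM; have [f [fn <-]] := norming_functional x.
have : [set l : R | l <= M] (f x); last by [].
apply: (closed_cvg _ (@closed_le R M) _ _ (vx f)).
by apply: nearW => k /=; rewrite (le_trans (ler_norm _))// (le_trans (fn _)).
Qed.

Lemma limn_esup_le_near (R : realType) (u : (\bar R)^nat) (c : \bar R) :
  (\forall n \near \oo, (u n <= c)%E) -> (limn_esup u <= c)%E.
Proof.
move=> uc; apply: ge_ereal_inf.
exists (ereal_sup (u @` [set n | (u n <= c)%E])).
  by exists [set n | (u n <= c)%E].
by apply: ge_ereal_sup => _ [n nc <-].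
Qed.

Lemma frechet_normal_cone_le (R : realType) (X : normedModType R)
    (Lambda : set X) (d : X) (xs : dual X) (eps : R) :
  frechet_normal_cone d Lambda xs -> 0 < eps ->
  exists2 r, 0 < r & forall v, Lambda v -> `|v - d| < r ->
    xs (v - d) <= eps * `|v - d|.
Proof.
move=> xsN eps0.
have /ereal_inf_lt[_ [V VL <-] supV] := le_lt_trans xsN (eps0 : (0 < eps%:E)%E).
(* Membership in [within Lambda d^'] unfolds to a neighbourhood of [d] with two side conditions. *)
have /nbhs_ballP[r /= r0 rV] :
  nbhs d (fun v => v != d -> Lambda v -> V v) := VL.
exists r => // v Lv vr; have [->|vd] := eqVneq v d.
  by rewrite subrr linear0 normr0 mulr0.
have vd0 : 0 < `|v - d| by rewrite normr_gt0 subr_eq0.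
rewrite -ler_pdivrMr// -lee_fin; apply: le_trans (ltW supV).
apply: ereal_sup_ubound; exists v => //; apply: rV => //.
by rewrite -ball_normE/= distrC.
Qed.

(** With step [t (k n)], the direction [(t (k n))^-1 *: (x (k n) - xbar) + delta *: b n] leads from
    [xbar] to the given point of [Omega]. *)
Lemma weak_contingent_cone_add (R : realType) (X : normedModType R)
    (Omega : set X) (xbar d w : X) (x b : nat -> X) (t : nat -> R)
    (k : nat -> nat) (delta : R) :
  weak_tangent_seq Omega xbar d x t -> (forall n, (n <= k n)%N) ->
  weakly_cvg b w ->
  (forall n, Omega (x (k n) + (t (k n) * delta) *: b n)) ->
  weak_contingent_cone xbar Omega (d + delta *: w).
Proof.
move=> [_ [t0 tcvg] xd] kn bw Ob.
have koo : k n @[n --> \oo] --> \oo.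
  apply/cvgnyPge => A; near=> n; apply: leq_trans (kn n); near: n.
  exact: nbhs_infty_ge.
exists (t \o k).
exists (fun n => (t (k n))^-1 *: (x (k n) - xbar) + delta *: b n); split.
- by split=> [n|]; [exact: t0 | exact: cvg_comp koo tcvg].
- move=> f; rewrite linearD linearZ/=.
  under eq_fun do rewrite linearD/= [X in _ + X]linearZ/=.
  apply: cvgD; first exact: (cvg_comp _ _ koo (xd f)).
  by apply: cvgZl_tmp; exact: bw.
- move=> n /=; rewrite scalerDr !scalerA divff ?gt_eqF// scale1r.
  by rewrite addrA [xbar + _]addrC subrK.
Unshelve. all: by end_near. Qed.

Lemma approx_normal_of_weak_tangent (R : realType) (X : normedModType R)
    (Omega : set X) (xbar d : X) (xs : dual X) (x : nat -> X) (t : nat -> R)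
    (eps : R) :
  reflexive_space X ->
  frechet_normal_cone d (weak_contingent_cone xbar Omega) xs ->
  weak_tangent_seq Omega xbar d x t -> 0 < eps ->
  exists delta,
    [/\ 0 < delta, delta < eps & approx_normal_ineq Omega xs x t eps delta].
Proof.
move=> hX xsN xt eps0.
have [r r0 xsr] := frechet_normal_cone_le xsN eps0.
have m0 : 0 < Num.min eps r by rewrite lt_min eps0.
(* Halving makes [delta] strictly less than both [eps] and [r], so [d + delta *: w] stays in the
   open ball of radius [r]. *)
pose delta := Num.min eps r / 2; have delta0 : 0 < delta by rewrite divr_gt0.
have : delta < Num.min eps r by rewrite ltr_pdivrMr// ltr_pMr// ltr1n.
rewrite lt_min => /andP[delta_eps delta_r]; exists delta; split=> //.
apply: contrapT => nle.
have /choice[kb kbP] (n : nat) : exists kb : nat * X,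
    [/\ (n <= kb.1)%N, `|kb.2| <= 1,
        Omega (x kb.1 + (t kb.1 * delta) *: kb.2) & 2 * eps <= xs kb.2].
  (* Without such a pair, the supremum is at most [2 * eps * delta] for every [k >= n]. For
     [z = x k + (t k * delta) *: b] the quotient is [delta * xs b]. *)
  apply: contrapT => nex; apply: nle; apply: limn_esup_le_near.
  exists n => // k /= nk; apply: ge_ereal_sup => _ [z [Oz [b b1 zE]] <-].
  rewrite -zE in Oz *; rewrite lee_fin leNgt; apply/negP => lt2; apply: nex.
  exists (k, b); split=> //=.
  move: lt2; rewrite addrC addKr linearZ/= /GRing.scale/=.
  have [_ [t0 _] _] := xt.
  rewrite ltr_pdivlMr// [ltLHS]mulrC (mulrC _ delta) mulrA.
  by rewrite ltr_pM2l ?mulr_gt0// => /ltW.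
have b1 n : `|(kb n).2| <= 1 by case: (kbP n).
have [j [w [jn bw]]] := weakly_cvg_subseq hX b1.
have Lw : weak_contingent_cone xbar Omega (d + delta *: w).
  apply: (weak_contingent_cone_add (k := fun n => (kb (j n)).1) xt _ bw) => n.
    by apply: leq_trans (jn n) _; case: (kbP (j n)).
  by case: (kbP (j n)).
have w1 : `|w| <= 1 by apply: weak_limit_norm_le bw _ => n; exact: b1.
have xsw : 2 * eps <= xs w.
  have : [set l : R | 2 * eps <= l] (xs w); last by [].
  apply: (closed_cvg _ (@closed_ge R (2 * eps)) _ _ (bw xs)).
  by apply: nearW => n /=; case: (kbP (j n)).
have dw : `|delta *: w| <= delta by rewrite normrZ gtr0_norm// ler_piMr// ltW.
have := xsr _ Lw; rewrite addrC addKr => /(_ (le_lt_trans dw delta_r)).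
rewrite linearZ/= normrZ gtr0_norm// mulrCA ler_pM2l//.
(* Dividing [2 * eps <= eps * |w|] by [eps] contradicts [|w| <= 1]. *)
move=> /(le_trans xsw); rewrite mulrC ler_pM2l// => w2.
by have := le_trans w2 w1; rewrite leNgt ltr1n.
Qed.

(** Supplies the sequence required by [TAN], namely [xbar + t k *: v k]. *)
Lemma weak_contingent_cone_tangent_seq (R : realType) (X : normedModType R)
    (Omega : set X) (xbar d : X) :
  weak_contingent_cone xbar Omega d ->
  exists x t, weak_tangent_seq Omega xbar d x t.
Proof.
move=> [t [v [t0 vd Ov]]]; exists (fun k => xbar + t k *: v k), t; split=> // f.
under eq_fun do rewrite addrC addKr scalerA mulVf ?gt_eqF ?t0.1// scale1r.
exact: vd.
Qed.

Theorem proposition6p3 (R : realType) (X : completeNormedModType R)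
    (hX : reflexive_space X) (Omega : set X) (xbar : X) (hxbar : Omega xbar) :
  (forall (d : X) (xs : dual X),
     weak_contingent_cone xbar Omega d ->
     frechet_normal_cone d (weak_contingent_cone xbar Omega) xs ->
     forall (x : nat -> X) (t : nat -> R),
       weak_tangent_seq Omega xbar d x t ->
       forall eps : R, 0 < eps ->
         exists delta : R, [/\ 0 < delta, delta < eps &
           approx_normal_ineq Omega xs x t eps delta]) /\
  TAN Omega xbar.
Proof.
split=> [d xs _ xsN x t xt eps|d xs Ld xsN].
  exact: (approx_normal_of_weak_tangent hX xsN xt).
have [x [t xt]] := weak_contingent_cone_tangent_seq Ld.
exists x, t; split=> // eps.
exact: (approx_normal_of_weak_tangent hX xsN xt).
Qed.
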